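(* Let $\lambda$ and $\mu$ be partitions. The toggle map $\nu\mapsto T(\nu)$ relative to $\mu$ and $\lambda$ is a bijection from the set of partitions $\nu$ with $\mu\succ\nu\succ\lambda$ to the set of partitions $\nu'$ with $\mu\succ\nu'\succ\lambda$, and it is weight-preserving in the following manner: for every such $\nu$, $$|\nu|-|\lambda|=|\mu|-|T(\nu)|\quad\text{and}\quad|\mu|-|\nu|=|T(\nu)|-|\lambda|.$$
   Context: A partition is a weakly decreasing sequence $\lambda=(\lambda_1,\lambda_2,\dots)$ of nonnegative integers with finitely many nonzero terms; $|\lambda|=\sum_i\lambda_i$. We write $\lambda\succ\mu$ if $\lambda_1\ge\mu_1\ge\lambda_2\ge\mu_2\ge\cdots$. Toggle: for partitions $\mu\succ\nu\succ\lambda$, the toggle of $\nu$ relative to $\mu$ and $\lambda$ is the partition $T(\nu)$ given by $$T(\nu)_i=\min\{\mu_i,\lambda_{i-1}\}+\max\{\mu_{i+1},\lambda_i\}-\nu_i\qquad(i\ge1),$$ where $\lambda_0=\infty$. *)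

(* Defs.v *)
From mathcomp Require Import all_boot all_order all_algebra.
From mathcomp Require Import all_classical.

Set Implicit Arguments.
Unset Strict Implicit.
Unset Printing Implicit Defensive.

Import Order.TTheory GRing.Theory Num.Theory.

Local Open Scope classical_set_scope.
Local Open Scope ring_scope.

(* Sequences are indexed from 0, so [l i] is the part $\lambda_{i+1}$. Parts are
   integers, required to be nonnegative, so that no subtraction truncates. *)
Definition is_partition (l : nat -> int) : Prop :=
  [/\ forall i, 0 <= l i,
      forall i, l i.+1 <= l i
    & finite_set [set i | l i != 0]].

(* The sum of the nonzero parts; it is meaningful when they are finitely many. *)
Definition weight (l : nat -> int) : int := \sum_(i \in [set: nat]) l i.

Definition interlaces (l m : nat -> int) : Prop :=
  forall i, m i <= l i /\ l i.+1 <= m i.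

Definition between (mu lam : nat -> int) : set (nat -> int) :=
  [set nu | [/\ is_partition nu, interlaces mu nu & interlaces nu lam]].

(* The case $i = 0$ is the convention $\lambda_0 = \infty$, under which
   $\min\{\mu_1, \lambda_0\} = \mu_1$. *)
Definition toggle (mu lam nu : nat -> int) : nat -> int := fun i =>
  (if i is j.+1 then Num.min (mu j.+1) (lam j) else mu 0%N)
  + Num.max (mu i.+1) (lam i) - nu i.

(* Main.v *)
(* Interlacing confines each [nu i] to the interval with endpoints the minimum
   and the maximum occurring in the toggle, and the toggle reflects [nu i] in the
   midpoint of that interval: it is an involution. Since min + max is the sum of
   the two arguments, the sum of [nu i + T(nu) i] over [i] telescopes to the total
   weight of [mu] and [lam]. *)
Require Import Defs.
From mathcomp Require Import all_boot all_order all_algebra.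
From mathcomp Require Import all_classical.
From mathcomp Require Import zify.

Import Order.TTheory GRing.Theory Num.Theory.

Local Open Scope classical_set_scope.
Local Open Scope ring_scope.

Lemma partition_eventually0 (l : nat -> int) :
  is_partition l -> exists n, forall i, (n <= i)%N -> l i = 0.
Proof.
case=> _ _ /finite_seqP[X lX]; exists (\max_(j <- X) j).+1 => i ltXi.
apply/eqP; apply: contraLR ltXi => li_neq0; rewrite -leqNgt.
have : [set i | l i != 0] i by [].
by rewrite lX /= => iX; exact: (leq_bigmax_seq (F := id)).
Qed.

(** Trades the sum over all of [nat] for a truncated one, on which induction is possible. *)
Lemma weight_ord (l : nat -> int) (n : nat) :
  (forall i, (n <= i)%N -> l i = 0) -> weight l = \sum_(i < n) l i.
Proof.
move=> l0; rewrite /weight fsbig_ord; apply/esym/fsbig_widen => // i [_ /=].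
by move=> /negP; rewrite -leqNgt => /l0.
Qed.

Lemma toggleK (mu lam nu : nat -> int) :
  toggle mu lam (toggle mu lam nu) = nu.
Proof. by apply/funext => i; rewrite /toggle subKr. Qed.

Lemma toggle_between (mu lam nu : nat -> int) :
  is_partition lam -> is_partition mu ->
  between mu lam nu -> between mu lam (toggle mu lam nu).
Proof.
move=> [lam0 _ _] [mu0 _ muF] [_ mn nl].
(* The first bound comes from [nu i] being at least the max, the other two from its being at most
   the min. *)
have TB i : [/\ toggle mu lam nu i <= mu i, mu i.+1 <= toggle mu lam nu i
             & lam i <= toggle mu lam nu i].
  rewrite /toggle; move: (mn i) (nl i).
  by case: i => [|i]; [|have := nl i]; split; lia.
have Tlam i : toggle mu lam nu i.+1 <= lam i.
  by rewrite /toggle; move: (mn i.+1) (nl i) (nl i.+1); lia.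
have T0 i : 0 <= toggle mu lam nu i by have [_ _] := TB i; exact: le_trans.
split=> [|i|i]; [split=> // [i|] | by have [] := TB i | by have [] := TB i].
(* The toggle decreases because [lam i] separates its consecutive terms. *)
- by have [_ _] := TB i; exact: le_trans.
- apply: sub_finite_set muF => i /=; apply: contra_neq => mui0.
  by apply/eqP; rewrite eq_le T0 -{1}mui0; have [-> _ _] := TB i.
Qed.

(** The min at index [j.+1] and the max at index [j] have the same arguments, [mu j.+1] and [lam j].
    Only the last max stays unpaired, so [lam] is summed over one index fewer. *)
Lemma sum_toggle (mu lam nu : nat -> int) (n : nat) :
  \sum_(i < n.+1) nu i + \sum_(i < n.+1) toggle mu lam nu i =
  \sum_(i < n.+1) mu i + \sum_(i < n) lam i + Num.max (mu n.+1) (lam n).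
Proof.
elim: n => [|n IHn]; first by rewrite !big_ord_recr !big_ord0 /toggle /=; lia.
rewrite [\sum_(i < n.+1) lam _]big_ord_recr 3!(big_ord_recr n.+1) /= addrACA IHn.
by rewrite [in RHS]addrACA -!addrA /toggle; congr (_ + (_ + _)); lia.
Qed.

Lemma weight_toggle (mu lam nu : nat -> int) :
  is_partition lam -> is_partition mu -> between mu lam nu ->
  weight nu + weight (toggle mu lam nu) = weight mu + weight lam.
Proof.
move=> hlam hmu nuB; have [hT _ _] := toggle_between _ _ _ hlam hmu nuB.
have [hnu _ _] := nuB.
have [a lam0] := partition_eventually0 _ hlam.
have [b mu0] := partition_eventually0 _ hmu.
have [c nu0] := partition_eventually0 _ hnu.
have [d T0] := partition_eventually0 _ hT.
(* All four sequences vanish from [n] on, so the unpaired max is [Num.max 0 0]. *)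
pose n := (a + b + c + d)%N.
rewrite (weight_ord lam n) => [|i ni]; last by apply: lam0; lia.
rewrite (weight_ord mu n.+1) => [|i ni]; last by apply: mu0; lia.
rewrite (weight_ord nu n.+1) => [|i ni]; last by apply: nu0; lia.
rewrite (weight_ord (toggle _ _ _) n.+1) => [|i ni]; last by apply: T0; lia.
by rewrite sum_toggle mu0 ?lam0 ?maxxx ?addr0 //; lia.
Qed.

Theorem proposition3p5 (lam mu : nat -> int)
    (hlam : is_partition lam) (hmu : is_partition mu) :
  set_bij (between mu lam) (between mu lam) (toggle mu lam) /\
  (forall nu : nat -> int, between mu lam nu ->
     weight nu - weight lam = weight mu - weight (toggle mu lam nu) /\
     weight mu - weight nu = weight (toggle mu lam nu) - weight lam).
Proof.
split=> [|nu nuB]; last by have := weight_toggle _ _ _ hlam hmu nuB; lia.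
split=> [nu nuB|nu nu' _ _ eqT|nu nuB]; first exact: toggle_between.
- by rewrite -(toggleK mu lam nu) eqT toggleK.
- by exists (toggle mu lam nu); [exact: toggle_between | exact: toggleK].
Qed.
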